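(* Let $q$ be a prime power, and let $n, k, m$ be positive integers such that $k < n$ and $m \leq q^k$. Then $$K(q,n,k,m) \geq \frac{1}{2^n}\, m^{n/k}.$$
   Context: $\mathbb{F}_q$ is the finite field with $q$ elements. For integers $1 \leq k < n$ and $m \geq 1$, a subset $S \subseteq \mathbb{F}_q^n$ is a $(k,m)$-Furstenberg set if for each $k$-dimensional linear subspace $W$ of $\mathbb{F}_q^n$ there is a translate of $W$ that intersects $S$ in at least $m$ points. For $1 \leq k < n$ and $m \leq q^k$, $K(q,n,k,m)$ denotes the least $t$ such that there exists a $(k,m)$-Furstenberg set in $\mathbb{F}_q^n$ of cardinality $t$. *)

(* Defs.v *)
From mathcomp Require Import all_boot all_algebra finfield all_classical.
Set Implicit Arguments.
Unset Strict Implicit.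
Unset Printing Implicit Defensive.
Import GRing.Theory.
Local Open Scope ring_scope.

(* F_q is any F : finFieldType with #|F| = q: such a q is always a prime power,
   and every prime power is the cardinality of some F (unique up to
   isomorphism).                                                             *)

Definition translate (F : finFieldType) (n : nat) (x : 'rV[F]_n)
    (W : {vspace 'rV[F]_n}) : {set 'rV[F]_n} :=
  [set x + w | w in W]%SET.

Definition furstenberg (F : finFieldType) (n k m : nat)
    (S : {set 'rV[F]_n}) : Prop :=
  forall W : {vspace 'rV[F]_n}, \dim W = k ->
    exists x : 'rV[F]_n, (m <= #|S :&: translate x W|)%N.

(* [arg min] needs a fallback candidate: the whole space, which is itself a
   (k, m)-Furstenberg set when m <= q ^ k, the only case where the number is
   meaningful (see furstenberg_numberP).                                     *)
Definition furstenberg_number (F : finFieldType) (n k m : nat) : nat :=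
  #|[arg min_(S < [set: 'rV[F]_n]%SET | `[< furstenberg k m S >]) #|S|]%N|.

Lemma card_translate (F : finFieldType) (n : nat) (x : 'rV[F]_n)
    (W : {vspace 'rV[F]_n}) : #|translate x W| = (#|F| ^ \dim W)%N.
Proof.
rewrite /translate card_imset; last by move=> u v; apply: addrI.
exact: card_vspace.
Qed.

Lemma furstenberg_setT (F : finFieldType) (n k m : nat) :
  (m <= #|F| ^ k)%N -> furstenberg k m [set: 'rV[F]_n]%SET.
Proof.
by move=> le_m W dimW; exists 0; rewrite finset.setTI card_translate dimW.
Qed.

Lemma furstenberg_numberP (F : finFieldType) (n k m : nat) :
  (m <= #|F| ^ k)%N ->
  (exists2 S : {set 'rV[F]_n},
     furstenberg k m S & #|S| = furstenberg_number F n k m) /\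
  (forall S : {set 'rV[F]_n},
     furstenberg k m S -> (furstenberg_number F n k m <= #|S|)%N).
Proof.
move=> le_m; rewrite /furstenberg_number.
case: arg_minnP => [|S /asboolP fS minS]; first exact/asboolP/furstenberg_setT.
by split=> [|S' fS']; [exists S | exact/minS/asboolP].
Qed.

(* Main.v *)
Require Import Defs.
From mathcomp Require Import all_boot all_order all_algebra all_classical reals exp.
From mathcomp Require Import ring zify.
Set Implicit Arguments.
Unset Strict Implicit.
Unset Printing Implicit Defensive.
Import Order.TTheory GRing.Theory Num.Theory.
Local Open Scope ring_scope.

(** Why the bound holds.  Let [S] be a [(k, m)]-Furstenberg set in [F^n], with
    [q = #|F|].  Projecting along a direction [b] turns a weight [w] on [F^n]
    into the weight on [F^(n-1)] whose values are the sums of [w] over the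
    lines of direction [b].  Start with the indicator of [S] and project
    [k] times, each time along the best direction: the final weights are
    the cardinalities of the intersections of [S] with the translates of one
    [k]-dimensional [W], and one of them is at least [m].  So it is enough to
    bound the growth of the maximal weight in one projection.

    This growth is controlled by a weighted Kakeya theorem
    ([weighted_kakeya]): if [w] is at most [A] and has total mass [T], and if
    every direction contains a line of weight at least [M], then
    [M^n <= 2^n * A^(n-1) * T].  Iterating it
    ([exists_light_subspace]), the powers of [A] telescope, and with [A = 1]
    and [T = #|S|] the result is [m^n <= 2^(k * n) * #|S|^k].

    The weighted Kakeya theorem is proved by the method of multiplicities
    ([multiplicity_kakeya]).  Take [N] large and [d = N * M - 1].  If there are
    more monomials of degree at most [d] than linear conditions, some nonzero
    polynomial [P] of degree [d' <= d] vanishes at each [x] to order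
    [2 * N * w x].  Let [|beta| <= d' / q].  The Hasse derivative of index
    [beta] of [P], restricted to a heavy line of direction [b], has degree at
    most [d' - |beta|] and, counted with multiplicity, at least
    [2 * N * M - q * |beta|] roots, which is more; hence it is zero
    ([hasse_line_dvd], [sum_root_mult_lt]).  Its coefficient of degree
    [d' - |beta|] is the same Hasse derivative of the top form of [P] at [b]
    ([hasse_line_top]), so the top form vanishes to order larger than [d' / q]
    at every point of [F^n].  The Schwartz-Zippel lemma with multiplicities
    ([hasse_nonvanishing]) forbids this.  So there are at least as many conditions as monomials;
    comparing the leading terms in [N] gives the inequality.  The factor 2 per
    dimension pays for the points lost to [beta].

    A polynomial in [n] variables, with degrees less than [D] in each of them,
    is represented by its coefficient function
    [c : {ffun 'I_n -> 'I_D} -> K]. *)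

(** * Hasse derivatives *)

(** The Hasse derivative of index [b], at the point [x], of the polynomial with
    coefficients [c], that is, the coefficient of [y^b] in the expansion of
    [c (x + y)].  The truncated subtraction is harmless: the binomial
    coefficient is zero when [e i < b i]. *)
Definition hasse (K : comNzRingType) (n D : nat) (c : {ffun 'I_n -> 'I_D} -> K)
    (b : 'I_n -> nat) (x : 'I_n -> K) : K :=
  \sum_e c e * \prod_i (x i ^+ (e i - b i) *+ 'C(e i, b i)).

(** Taylor expansion of a Hasse derivative of a single monomial in one
    variable. *)
Lemma exprD_bin (K : comNzRingType) (D e b : nat) (x y : K) : (e < D)%N ->
  (x + y) ^+ (e - b) *+ 'C(e, b) =
  \sum_(g < D) (y ^+ g *+ 'C(b + g, b)) * (x ^+ (e - (b + g)) *+ 'C(e, b + g)).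
Proof.
move=> ltD.
have F (g : nat) : (y ^+ g *+ 'C(b + g, b)) * (x ^+ (e - (b + g)) *+ 'C(e, b + g))
    = (x ^+ (e - b - g) * y ^+ g *+ 'C(e - b, g)) *+ 'C(e, b).
  rewrite mulrnAl mulrnAr -!mulrnA subnDA mulrC; congr (_ *+ _).
  have [lebe|ltbe] := leqP (b + g) e; last first.
    rewrite (@bin_small e (b + g)) //.
    have [lebe|lteb] := leqP b e; last by rewrite (@bin_small e b) ?muln0.
    by rewrite (@bin_small (e - b) g) //; lia.
  (* Both sides times b! g! (e - b - g)! are equal to e!. *)
  have fg : (0 < b`! * g`! * (e - (b + g))`!)%N by rewrite !muln_gt0 !fact_gt0.
  apply/eqP; rewrite -(eqn_pmul2r fg); apply/eqP.
  have E1 := bin_fact lebe.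
  have lb : (b <= b + g)%N by lia.
  have E2 := bin_fact lb; rewrite addKn in E2.
  have lbe : (b <= e)%N by lia.
  have E3 := bin_fact lbe.
  have lge : (g <= e - b)%N by lia.
  have E4 := bin_fact lge; rewrite -subnDA in E4.
  transitivity e`!; first by rewrite -E1 -E2; ring.
  by rewrite -E3 -E4; ring.
have [lteb|lebe] := ltnP e b.
  rewrite bin_small // mulr0n big1 // => g _.
  by rewrite F (@bin_small e b) ?mulr0n.
rewrite exprDn -sumrMnl.
under [RHS]eq_bigr do rewrite F.
have le1 : ((e - b).+1 <= D)%N by lia.
rewrite (big_ord_widen D
  (fun g => x ^+ (e - b - g) * y ^+ g *+ 'C(e - b, g) *+ 'C(e, b)) le1).
rewrite big_mkcond /=; apply: eq_bigr => g _.
by case: ltnP => // ?; rewrite bin_small ?mulr0n ?mul0rn.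
Qed.

(** Taylor's formula; composing the derivatives of indices [g] and [b] gives
    the derivative of index [b + g], up to a product of binomial
    coefficients. *)
Lemma hasse_taylor (K : comNzRingType) (n D : nat) (c : {ffun 'I_n -> 'I_D} -> K)
    (b : 'I_n -> nat) (x y : 'I_n -> K) :
  hasse c b (fun i => x i + y i) =
  \sum_(g : {ffun 'I_n -> 'I_D})
     (\prod_i (y i ^+ g i *+ 'C(b i + g i, b i))) *
     hasse c (fun i => b i + g i)%N x.
Proof.
rewrite /hasse.
under [RHS]eq_bigr do rewrite mulr_sumr.
rewrite exchange_big /=; apply: eq_bigr => e _.
under eq_bigr do rewrite (exprD_bin _ _ _ (ltn_ord (e _))).
rewrite bigA_distr_bigA mulr_sumr /=; apply: eq_bigr => g _.
by rewrite big_split /= mulrCA.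
Qed.

Lemma hasse_map (K L : comNzRingType) (f : {rmorphism K -> L}) (n D : nat)
    (c : {ffun 'I_n -> 'I_D} -> K) (b : 'I_n -> nat) (x : 'I_n -> K) :
  hasse (f \o c) b (f \o x) = f (hasse c b x).
Proof.
rewrite /hasse rmorph_sum; apply: eq_bigr => e _ /=.
rewrite rmorphM rmorph_prod; congr (_ * _); apply: eq_bigr => i _.
by rewrite rmorphMn rmorphXn.
Qed.

Lemma eq_hasse (K : comNzRingType) (n D : nat) (c : {ffun 'I_n -> 'I_D} -> K)
    (b b' : 'I_n -> nat) (x x' : 'I_n -> K) : b =1 b' -> x =1 x' ->
  hasse c b x = hasse c b' x'.
Proof.
move=> eb ex; apply: eq_bigr => e _; congr (_ * _).
by apply: eq_bigr => i _; rewrite eb ex.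
Qed.

(** The polynomial [c] vanishes at [x] to order at least [r]. *)
Definition vanishes (K : comNzRingType) (n D : nat) (c : {ffun 'I_n -> 'I_D} -> K)
    (r : nat) (x : 'I_n -> K) : Prop :=
  forall b : 'I_n -> nat, (\sum_i b i < r)%N -> hasse c b x = 0.

(** * Restriction to lines *)

(** The Hasse derivative of index [b] of [c] restricted to the line
    [t |-> x + t v], as a polynomial in [t]. *)
Definition hasse_line (F : fieldType) (n D : nat) (c : {ffun 'I_n -> 'I_D} -> F)
    (b : 'I_n -> nat) (x v : 'I_n -> F) : {poly F} :=
  hasse (polyC \o c) b (fun i => (x i)%:P + v i *: 'X).

(** Differentiating [|b|] times lowers the order of vanishing by at most
    [|b|]. *)
Lemma hasse_line_dvd (F : fieldType) (n D : nat) (c : {ffun 'I_n -> 'I_D} -> F)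
    (b : 'I_n -> nat) (x v : 'I_n -> F) (t : F) (r : nat) :
  vanishes c r (fun i => x i + t * v i) ->
  ('X - t%:P) ^+ (r - \sum_i b i) %| hasse_line c b x v.
Proof.
move=> cr.
have -> : hasse_line c b x v = hasse (polyC \o c) b
    (fun i => (polyC \o (fun j => (x j + t * v j)%R)) i + v i *: ('X - t%:P)).
  apply: eq_hasse => // i /=.
  rewrite scalerBr polyCD polyCM -[v i *: t%:P]mul_polyC mulrC; ring.
rewrite hasse_taylor.
apply: (big_ind (fun p => _ %| p)) => [||g _]; [exact: dvdp0|exact: dvdp_add|].
rewrite hasse_map.
have [lt|le] := ltnP (\sum_i (b i + g i)) r.
  by rewrite cr // mulr0 dvdp0.
apply: dvdp_mulr.
have -> : \prod_i ((v i *: ('X - t%:P)) ^+ g i *+ 'C(b i + g i, b i)) =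
   ('X - t%:P) ^+ (\sum_i g i)
     * \prod_i ((v i ^+ g i)%:P *+ 'C(b i + g i, b i)).
  rewrite -prodrXr -big_split /=; apply: eq_bigr => i _.
  by rewrite exprZn mulrnAr -mul_polyC mulrC.
apply: dvdp_mulr; apply: dvdp_exp2l.
by rewrite leq_subLR -big_split.
Qed.

(** If each [p i] has degree at most [k i], the product of the [p i] has degree at
    most the sum of the [k i], and the coefficients of these degrees multiply. *)
Lemma coef_prod_lead (R : comNzRingType) (I : Type) (s : seq I)
    (p : I -> {poly R}) (k : I -> nat) :
  (forall i, (size (p i) <= (k i).+1)%N) ->
  (size (\prod_(i <- s) p i)%R <= (\sum_(i <- s) k i).+1)%N /\
  (\prod_(i <- s) p i)`_(\sum_(i <- s) k i) = \prod_(i <- s) (p i)`_(k i).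
Proof.
move=> pk; elim: s => [|i s [IH1 IH2]].
  by rewrite !big_nil size_poly1 coef1.
rewrite !big_cons; split.
  apply: leq_trans (size_polyMleq _ _) _.
  by have := pk i; lia.
rewrite coefM (bigD1 (Ordinal (leq_addr (\sum_(j <- s) k j) (k i) : k i < _.+1)%N)) //=.
rewrite addKn IH2 [X in _ + X]big1 ?addr0 // => j neq.
have [lt|le] := ltnP j (k i).
  rewrite mulrC nth_default ?mul0r //; apply: leq_trans IH1 _; lia.
rewrite nth_default ?mul0r //; apply: leq_trans (pk i) _.
suff: (j != k i :> nat) by lia.
by apply: contra neq => /eqP e; apply/eqP/val_inj.
Qed.

(** The homogeneous component of degree [d]. *)
Definition top_form (K : comNzRingType) (n D : nat)
    (c : {ffun 'I_n -> 'I_D} -> K) (d : nat) (e : {ffun 'I_n -> 'I_D}) : K :=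
  if (\sum_i e i == d)%N then c e else 0.

(** On a line of direction [v], only the monomials of degree [d] contribute to
    the coefficient of degree [d - |b|], and the base point does not matter. *)
Lemma hasse_line_top (F : fieldType) (n D : nat) (c : {ffun 'I_n -> 'I_D} -> F)
    (b : 'I_n -> nat) (x v : 'I_n -> F) (d : nat) :
  (forall e, c e != 0 -> (\sum_i e i <= d)%N) -> (\sum_i b i <= d)%N ->
  (size (hasse_line c b x v) <= (d - \sum_i b i).+1)%N /\
  (hasse_line c b x v)`_(d - \sum_i b i) = hasse (top_form c d) b v.
Proof.
move=> cd bd; rewrite /hasse_line /hasse.
pose p (e : {ffun 'I_n -> 'I_D}) i : {poly F} :=
  (((x i)%:P + v i *: 'X) ^+ (e i - b i) *+ 'C(e i, b i)).
have main (e : {ffun 'I_n -> 'I_D}) :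
  (size ((c e)%:P * \prod_i p e i)%R <= (d - \sum_i b i).+1)%N /\
  ((c e)%:P * \prod_i p e i)`_(d - \sum_i b i) =
     top_form c d e * \prod_i (v i ^+ (e i - b i) *+ 'C(e i, b i)).
  have [ce0|cen0] := eqVneq (c e) 0.
    rewrite ce0 mul0r size_poly0 coef0 /top_form ce0; split=> //.
    by case: ifP; rewrite mul0r.
  have led := cd e cen0.
  have [/forallP be|] := boolP [forall i, (b i <= e i)%N]; last first.
    rewrite negb_forall => /existsP[i]; rewrite -ltnNge => lt.
    rewrite (bigD1 i) //= /p bin_small // mulr0n mul0r mulr0.
    rewrite [in RHS](bigD1 i) //= bin_small // mulr0n mul0r mulr0.
    by rewrite size_poly0 coef0.
  have lin i : (size ((x i)%:P + v i *: 'X)%R <= 2)%N.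
    apply: leq_trans (size_polyD _ _) _; rewrite geq_max.
    rewrite (leq_trans (size_polyC_leq1 _)) //=.
    by apply: leq_trans (size_scale_leq _ _) _; rewrite size_polyX.
  have pows i k : (size (((x i)%:P + v i *: 'X) ^+ k)%R <= k.+1)%N /\
      (((x i)%:P + v i *: 'X) ^+ k)`_k = v i ^+ k.
    have [] := coef_prod_lead (index_enum 'I_k) (fun=> lin i).
    rewrite !prodr_const !sum_nat_const !card_ord muln1.
    by rewrite coefD coefC coefZ coefX /= mulr1 add0r.
  have szp i : (size (p e i) <= (e i - b i).+1)%N.
    rewrite /p -scaler_nat; apply: leq_trans (size_scale_leq _ _) _.
    by case: (pows i (e i - b i)%N).
  have cfp i : (p e i)`_(e i - b i) = v i ^+ (e i - b i) *+ 'C(e i, b i).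
    by rewrite /p coefMn; case: (pows i (e i - b i)%N) => _ ->.
  have sume : (\sum_i (e i - b i) = \sum_i e i - \sum_i b i)%N.
    by apply: sumnB => i _; apply: be.
  have [S1 S2] := coef_prod_lead (index_enum 'I_n) szp.
  rewrite sume in S1 S2.
  have lbe : (\sum_i b i <= \sum_i e i)%N by apply: leq_sum.
  rewrite mul_polyC; split.
    by apply: leq_trans (size_scale_leq _ _) _; apply: leq_trans S1 _; lia.
  rewrite coefZ /top_form; case: eqP => [<-|ne].
    by rewrite S2; congr (_ * _); apply: eq_bigr => i _; rewrite cfp.
  by rewrite mul0r nth_default ?mulr0 //; apply: leq_trans S1 _; lia.
split.
  apply: (big_ind (fun p : {poly F} => (size p <= _)%N)) => [|p1 p2 s1 s2|e _].
  - by rewrite size_poly0.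
  - by apply: leq_trans (size_polyD _ _) _; rewrite geq_max s1.
  - by case: (main e).
by rewrite coef_sum; apply: eq_bigr => e _; case: (main e).
Qed.

(** * Multiplicities of roots over a finite field *)

Lemma sum_root_mult_lt (F : finFieldType) (g : {poly F}) (r : F -> nat) :
  g != 0 -> (forall t, ('X - t%:P) ^+ r t %| g) -> (\sum_t r t < size g)%N.
Proof.
move=> g0 rg.
have dvd (s : seq F) : uniq s -> \prod_(t <- s) ('X - t%:P) ^+ r t %| g.
  elim: s => [|t s IH] /=; first by rewrite big_nil dvd1p.
  case/andP=> ts us; rewrite big_cons Gauss_dvdp ?rg ?IH //.
  rewrite big_seq_cond; apply: (big_ind (fun p => coprimep _ p)) => [|p1 p2 c1 c2|y].
  - exact: coprimep1.
  - by rewrite coprimepMr c1.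
  - rewrite andbT => ys; apply/coprimep_expl/coprimep_expr/coprimep_XsubC2.
    by rewrite subr_eq0; apply: contraNneq ts => <-.
have := dvdp_leq g0 (dvd _ (index_enum_uniq F)).
apply: leq_trans; rewrite size_prod => [|t _]; last first.
  by rewrite expf_neq0 // polyXsubC_eq0.
rewrite [X in (_ < X.+1 - _)%N](eq_bigr (fun t => r t + 1)%N) => [|t _]; last first.
  by rewrite size_exp_XsubC addn1.
by rewrite big_split /= sum1_card -addSn addnK.
Qed.

Lemma dvdp_nderivn (F : fieldType) (p : {poly F}) (x : F) (r : nat) :
  (forall j, (j < r)%N -> p^`N(j).[x] = 0) -> ('X - x%:P) ^+ r %| p.
Proof.
move=> pr; rewrite -[p]comp_polyXr /comp_poly -[X in _.[X]](subrK x%:P) [_ - _ + _]addrC.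
rewrite nderiv_taylor; last exact: mulrC.
apply: (big_ind (fun p => _ %| p)) => [||j _]; [exact: dvdp0|exact: dvdp_add|].
rewrite nderivn_map horner_map /=.
have [lt|le] := ltnP j r; first by rewrite pr // mul0r dvdp0.
exact/dvdp_mull/dvdp_exp2l.
Qed.

(** A nonzero polynomial of degree at most [s] has multiplicity at most
    [s / #|F|] at some point of [F]. *)
Lemma nderivn_nonvanishing (F : finFieldType) (p : {poly F}) (s : nat) :
  p != 0 -> (size p <= s.+1)%N ->
  exists x j, (#|F| * j <= s)%N /\ p^`N(j).[x] != 0.
Proof.
move=> p0 ps.
have q0 : (0 < #|F|)%N by apply/card_gt0P; exists 0.
suff: ~ (forall (x : F) j, (j < (s %/ #|F|).+1)%N -> p^`N(j).[x] = 0).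
  move=> H; apply: contrapT => H'; apply: H => x j; rewrite ltnS leq_divRL // mulnC => lt.
  by apply: contrapT => /eqP ne; apply: H'; exists x, j.
move=> H.
have := sum_root_mult_lt p0 (fun x => dvdp_nderivn (H x)).
rewrite sum_nat_const => lt.
by have := leq_trans lt ps; rewrite ltnS leqNgt mulnC ltn_ceil.
Qed.

Lemma prod_ltS (K : comNzRingType) (n j : nat) (jn : (j < n)%N) (f : 'I_n -> K) :
  \prod_(i < n | (i < j.+1)%N) f i =
    f (Ordinal jn) * \prod_(i < n | (i < j)%N) f i.
Proof.
rewrite (bigD1 (Ordinal jn)) /= ?ltnSn //; congr (_ * _).
apply: eq_bigl => i; rewrite -(inj_eq val_inj) /=; lia.
Qed.

(** The Schwartz-Zippel lemma with multiplicities, as used below: a nonzero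
    polynomial of degree at most [d] vanishes to order at most [d / #|F|] at
    some point.  The proof is by induction on the number [j] of active
    variables: all the monomials of [c] have the same exponents in the others.
    In the inductive step the induction hypothesis is applied to the leading
    coefficient of [c] in the last active variable, and the point and
    derivative so found leave a univariate polynomial of the same degree in
    that variable. *)
Lemma hasse_nonvanishing (F : finFieldType) (n D : nat)
    (c : {ffun 'I_n -> 'I_D} -> F) (d : nat) :
  (exists e, c e != 0) -> (forall e, c e != 0 -> (\sum_i e i <= d)%N) ->
  exists x b, (#|F| * \sum_i b i <= d)%N /\ hasse c b x != 0.
Proof.
move=> cn0 cd.
suff main (j : nat) : (j <= n)%N ->
  forall (c : {ffun 'I_n -> 'I_D} -> F) (d : nat),
  (exists e, c e != 0) ->
  (forall e e', c e != 0 -> c e' != 0 -> forall i : 'I_n, (j <= i)%N -> e i = e' i) ->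
  (forall e, c e != 0 -> (\sum_(i < n | (i < j)%N) e i <= d)%N) ->
  exists (x : 'I_n -> F) (b : 'I_n -> nat),
    (forall i : 'I_n, (j <= i)%N -> b i = 0%N) /\ (#|F| * \sum_i b i <= d)%N /\
    \sum_e c e * \prod_(i < n | (i < j)%N) (x i ^+ (e i - b i) *+ 'C(e i, b i)) != 0.
  have [||x [b [_ [bd ne]]]] := main n (leqnn n) c d cn0.
  - by move=> e e' _ _ i; rewrite leqNgt ltn_ord.
  - by move=> e ce; under eq_bigl do rewrite ltn_ord; apply: cd.
  exists x, b; split=> //; congr (_ != 0): ne; apply: eq_bigr => e _.
  by congr (_ * _); apply: eq_bigl => i; rewrite ltn_ord.
elim: j => [|j IH] jn {cn0 cd d}c d [e0 ce0] cE cd.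
  exists (fun=> 0), (fun=> 0%N); split=> //; split; first by rewrite sum_nat_const !muln0.
  rewrite (bigD1 e0) //= big_pred0 // mulr1 big1 ?addr0 // => e ne.
  rewrite big_pred0 // mulr1; apply: contraNeq ne => ce.
  by apply/eqP/ffunP => i; apply: cE.
pose J := Ordinal jn.
(* t is the degree of c in the variable J; c' is its leading coefficient. *)
case: (@arg_maxnP _ e0 (fun e => c e != 0)
  (fun e : {ffun 'I_n -> 'I_D} => e J) ce0) => /= em cem emax.
set t := nat_of_ord (em J) in emax *.
pose c' (e : {ffun 'I_n -> 'I_D}) := if e J == t :> nat then c e else 0.
have c'n0 e : c' e != 0 -> c e != 0 /\ e J = t :> nat.
  by rewrite /c'; case: ifP => [/eqP|_]; [split|rewrite eqxx].
have sumS (f : 'I_n -> nat) :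
    (\sum_(i < n | (i < j.+1)%N) f i = f J + \sum_(i < n | (i < j)%N) f i)%N.
  rewrite (bigD1 J) /= ?ltnSn //; congr (_ + _)%N.
  apply: eq_bigl => i; rewrite -(inj_eq val_inj) /=; lia.
have td : (t <= d)%N by have := cd _ cem; rewrite sumS -/t; lia.
have [|||x [b [b0 [bd ne]]]] := IH (ltnW jn) c' (d - t)%N.
- by exists em; rewrite /c' eqxx.
- move=> e e' /c'n0[ce et] /c'n0[ce' e't] i; rewrite leq_eqVlt => /predU1P[ji|ji].
    have -> : i = J by apply: val_inj.
    by apply: val_inj; rewrite /= et.
  exact: cE.
- by move=> e /c'n0[ce et]; have := cd _ ce; rewrite sumS et; lia.
pose h (e : {ffun 'I_n -> 'I_D}) :=
  \prod_(i < n | (i < j)%N) (x i ^+ (e i - b i) *+ 'C(e i, b i)).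
(* The other variables being specialized at x, what remains is a polynomial u
   in the variable J; its coefficient of degree t is not zero. *)
pose u := \sum_(e : {ffun 'I_n -> 'I_D}) (c e * h e) *: 'X^(e J).
have ut : u`_t = \sum_e c' e * h e.
  rewrite coef_sum; apply: eq_bigr => e _; rewrite coefZ coefXn /c' eq_sym.
  by case: eqP => _; rewrite ?mulr1 // mulr0 mul0r.
have u0 : u != 0 by apply: contraNneq ne => u0; rewrite -ut u0 coef0.
have su : (size u <= t.+1)%N.
  apply: (big_ind (fun p : {poly F} => (size p <= t.+1)%N)) => [|p1 p2 s1 s2|e _].
  - by rewrite size_poly0.
  - by apply: leq_trans (size_polyD _ _) _; rewrite geq_max s1.
  have [->|ce] := eqVneq (c e) 0; first by rewrite mul0r scale0r size_poly0.
  by apply: leq_trans (size_scale_leq _ _) _; rewrite size_polyXn ltnS emax.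
have [xJ [bJ [bJt ne']]] := nderivn_nonvanishing u0 su.
pose x' i := if i == J then xJ else x i.
pose b' i := if i == J then bJ else b i.
exists x', b'; split.
  move=> i ji; rewrite /b' ifN ?b0 ?(ltnW ji) //.
  by apply: contraTneq ji => ->; rewrite ltnn.
split.
  rewrite (bigD1 J) //= {1}/b' eqxx.
  have le : (\sum_(i | i != J) b' i <= \sum_i b i)%N.
    rewrite [X in (_ <= X)%N](bigD1 J) //= -[X in (X <= _)%N]add0n leq_add //.
    by apply: leq_sum => i; rewrite /b' => /negPf ->.
  rewrite mulnDr -(subnKC td) leq_add //.
  by apply: leq_trans bd; rewrite leq_mul2l le orbT.
congr (_ != 0): ne'; rewrite /u.
have -> : (\sum_(e : {ffun 'I_n -> 'I_D}) (c e * h e) *: 'X^(e J))^`N(bJ)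
   = \sum_(e : {ffun 'I_n -> 'I_D}) ((c e * h e) *: 'X^(e J))^`N(bJ).
  by apply: (big_morph (fun p : {poly F} => p^`N(bJ))); [exact: linearD|exact: linear0].
rewrite horner_sum; apply: eq_bigr => e _.
rewrite linearZ /= nderivnXn hornerZ hornerMn hornerXn prod_ltS -/J.
rewrite /x' /b' eqxx -mulrA; congr (_ * _); rewrite mulrC; congr (_ * _).
apply: eq_bigr => i ij; have /negPf -> // : i != J.
by apply: contraTneq ij => ->; rewrite ltnn.
Qed.

(** * Interpolation with multiplicities *)

(** A homogeneous linear system with fewer equations (indexed by [B]) than
    unknowns (indexed by [A]) has a nonzero solution. *)
Lemma exists_annihilator (F : fieldType) (I J : finType) (A : {set I}) (B : {set J})
    (M : I -> J -> F) : (#|B| < #|A|)%N ->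
  exists c : I -> F, [/\ exists i, c i != 0, forall i, c i != 0 -> i \in A
    & forall j, j \in B -> \sum_i c i * M i j = 0].
Proof.
move=> ltBA.
pose X := \matrix_(i < #|A|, j < #|B|) M (enum_val i) (enum_val j).
have kn0 : kermx X != 0.
  rewrite -mxrank_eq0 mxrank_ker subn_eq0 -ltnNge.
  exact: leq_ltn_trans (rank_leq_col _) ltBA.
set v := nz_row (kermx X).
have v0 : v != 0 by rewrite nz_row_eq0.
have vX : v *m X = 0 by apply/sub_kermxP/nz_row_sub.
pose c i := \sum_k v 0 k *+ (enum_val k == i).
have cv k : c (enum_val k) = v 0 k.
  rewrite /c (bigD1 k) //= eqxx big1 ?addr0 // => l lk.
  by rewrite (inj_eq enum_val_inj) (negPf lk).
exists c; split.
- have /existsP[k vk] : [exists k, v 0 k != 0].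
    apply: contraR v0; rewrite negb_exists => /forallP v0.
    by apply/eqP/rowP => k; rewrite mxE; apply/eqP; have := v0 k; rewrite negbK.
  by exists (enum_val k); rewrite cv.
- move=> i; apply: contraNT => iA; rewrite /c big1 // => k _.
  by case: eqP => // ki; move: (enum_valP k); rewrite ki (negPf iA).
move=> j jB; have /rowP/(_ (enum_rank_in jB j)) := vX; rewrite !mxE => vX0.
rewrite -[RHS]vX0 /c; under eq_bigr do rewrite mulr_suml.
rewrite exchange_big /=; apply: eq_bigr => k _.
rewrite mxE enum_rankK_in // (bigD1 (enum_val k)) //= eqxx big1 ?addr0 // => i.
by rewrite eq_sym => /negPf ->; rewrite mul0r.
Qed.

(** There are at most [C(n + s, n)] monomials of degree at most [s] in [n]
    variables, whatever the bound [D] on the individual exponents; they are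
    all counted when [D = s + 1]. *)
Lemma card_exponents_le (n D s : nat) :
  (#|[set e : {ffun 'I_n -> 'I_D} | \sum_i e i <= s]%SET| <= 'C(n + s, n))%N.
Proof.
rewrite -card_partial_ord_partitions.
pose f (e : {ffun 'I_n -> 'I_D}) : n.-tuple 'I_s.+1 := [tuple inord (e i) | i < n].
have es (e : {ffun 'I_n -> 'I_D}) i : (\sum_i e i <= s)%N -> (e i < s.+1)%N.
  by rewrite ltnS; apply: leq_trans; rewrite (bigD1 i) //= leq_addr.
rewrite -(@card_in_imset _ _ f); last first.
  move=> e e'; rewrite !inE => se se' /(congr1 (fun t => tnth t)) ff.
  apply/ffunP => i; apply: val_inj.
  have /(congr1 (@nat_of_ord _)) := congr1 (fun t => t i) ff.
  by rewrite !tnth_mktuple !inordK ?es.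
apply/subset_leq_card/fintype.subsetP => t /imsetP[e]; rewrite !inE => se ->.
rewrite big_tuple; apply: leq_trans (se); apply: eq_leq.
by apply: eq_bigr => i _; rewrite tnth_mktuple inordK ?es.
Qed.

Lemma card_exponents (n d : nat) :
  ('C(n + d, n) <= #|[set e : {ffun 'I_n -> 'I_d.+1} | \sum_i e i <= d]%SET|)%N.
Proof.
rewrite -card_partial_ord_partitions.
pose f (t : n.-tuple 'I_d.+1) : {ffun 'I_n -> 'I_d.+1} := [ffun i => tnth t i].
rewrite -(@card_in_imset _ _ f); last first.
  move=> t t' _ _ /ffunP ff; apply: eq_from_tnth => i.
  by have := ff i; rewrite !ffunE.
apply/subset_leq_card/fintype.subsetP => e /imsetP[t]; rewrite !inE => st ->.
rewrite big_tuple in st; apply: leq_trans st; apply: eq_leq.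
by apply: eq_bigr => i _; rewrite ffunE.
Qed.

(** * The weighted Kakeya theorem *)

(** The polynomial argument: otherwise the [C(n + d, n)] monomials of degree at
    most [d = N * M - 1] outnumber the conditions of vanishing to order
    [2 * N * w x] at each [x].  The direction [b = 0] is allowed, its lines
    being single points counted [#|F|] times. *)
Lemma multiplicity_kakeya (F : finFieldType) (n : nat) (w : 'rV[F]_n -> nat)
    (M N : nat) : (0 < N * M)%N ->
  (forall b, exists a, (M <= \sum_(t : F) w (a + t *: b)%R)%N) ->
  ('C(n + (N * M).-1, n) <=
     \sum_(x | 0 < w x) 'C(n + (N * w x).*2.-1, n))%N.
Proof.
move=> NM0 line; rewrite leqNgt; apply/negP => ltBA.
set d := (N * M).-1 in ltBA; set r := fun x => (N * w x).*2.
pose A := [set e : {ffun 'I_n -> 'I_d.+1} | (\sum_i e i <= d)%N]%SET.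
pose B := [set p : 'rV[F]_n * {ffun 'I_n -> 'I_d.+1} | (\sum_i p.2 i < r p.1)%N]%SET.
have cBA : (#|B| < #|A|)%N.
  apply: leq_trans (card_exponents n d); apply: leq_ltn_trans ltBA.
  rewrite -sum1_card (eq_bigl (fun p : 'rV[F]_n * {ffun 'I_n -> 'I_d.+1} =>
     xpredT p.1 && (\sum_i p.2 i < r p.1)%N)) => [|p]; last by rewrite inE.
  rewrite -(pair_big_dep xpredT (fun x (e : {ffun 'I_n -> 'I_d.+1}) =>
     (\sum_i e i < r x)%N) (fun _ _ => 1%N)) /= [X in (_ <= X)%N]big_mkcond /=.
  apply: leq_sum => x _; rewrite sum1_card.
  have [w0|w0] := posnP (w x).
    rewrite leqn0; apply/eqP/eq_card0 => e.
    by rewrite /in_mem /= /r w0 muln0.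
  have r0 : (0 < r x)%N by rewrite double_gt0 muln_gt0 w0; case: (N) NM0.
  apply: leq_trans (card_exponents_le n d.+1 (r x).-1); apply: eq_leq.
  by apply: eq_card => e; rewrite inE /in_mem /= -ltnS prednK.
have [c [cn0 cA cB]] := exists_annihilator
  (fun (e : {ffun 'I_n -> 'I_d.+1}) (p : 'rV[F]_n * {ffun 'I_n -> 'I_d.+1}) =>
     \prod_i (p.1 0 i ^+ (e i - p.2 i) *+ 'C(e i, p.2 i))) cBA.
have van x : vanishes c (r x) (fun i => x 0 i).
  move=> b br.
  (* A derivative of order larger than d in some variable is zero, so only the
     indices in B matter. *)
  have [/forallP bd|] := boolP [forall i, (b i < d.+1)%N]; last first.
    rewrite negb_forall => /existsP[i]; rewrite -leqNgt => lt.
    apply: big1 => e _; rewrite (bigD1 i) //= bin_small ?mulr0n ?mul0r ?mulr0 //.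
    exact: leq_trans (ltn_ord _) lt.
  pose b' : {ffun 'I_n -> 'I_d.+1} := [ffun i => Ordinal (bd i)].
  have bb' i : b i = b' i by rewrite ffunE.
  rewrite (eq_hasse _ bb' (fun=> erefl)); apply: (cB (x, b')).
  by rewrite inE /=; under eq_bigr do rewrite -bb'.
have [e0 ce0] := cn0.
(* d' is the actual degree of the polynomial. *)
case: (@arg_maxnP _ e0 (fun e => c e != 0)
  (fun e : {ffun 'I_n -> 'I_d.+1} => (\sum_i e i)%N) ce0) => /= em cem emax.
set d' := (\sum_i em i)%N in emax.
have d'd : (d' <= d)%N by have := cA _ cem; rewrite inE.
have [|e|x [b [bd']]] := @hasse_nonvanishing F n d.+1 (top_form c d') d'.
- by exists em; rewrite /top_form eqxx.
- by rewrite /top_form; case: ifP => [/eqP -> //|_]; rewrite eqxx.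
have q0 : (0 < #|F|)%N by apply/card_gt0P; exists 0.
have leb : (\sum_i b i <= d')%N by apply: leq_trans bd'; rewrite leq_pmull.
move=> /eqP; apply.
have [a aM] := line (\row_i x i).
have [sg <-] := hasse_line_top (fun i => a 0 i) x emax leb.
set g := hasse_line _ _ _ _ in sg *.
have [->|g0] := eqVneq g 0; first by rewrite coef0.
have dvd t : ('X - t%:P) ^+ (r (a + t *: \row_i x i)%R - \sum_i b i)%N %| g.
  apply: hasse_line_dvd => b' lt; rewrite -(van (a + t *: \row_i x i) b') //.
  by apply: eq_hasse => // i; rewrite !mxE.
have := leq_trans (sum_root_mult_lt g0 dvd) sg.
rewrite ltnS leqNgt => /negP []; set S := (X in (_ < X)%N).
have le1 : ((N * M).*2 <= S + #|F| * \sum_i b i)%N.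
  rewrite -[X in (_ + X)%N]sum_nat_const -big_split /=.
  apply: (@leq_trans (\sum_t r (a + t *: \row_i x i)%R)).
    rewrite /r -(big_morph double doubleD double0) -big_distrr /= leq_double.
    by rewrite leq_mul2l aM orbT.
  by apply: leq_sum => t _; rewrite addnC -leq_subLR.
have NMd : (N * M = d.+1)%N by rewrite prednK.
rewrite NMd in le1; move: bd' le1 d'd; clearbody S d d'.
by move: (\sum_i b i)%N (#|F| * _)%N => s Q; lia.
Qed.

Lemma expn_homo (e : nat) : {homo (fun m => m ^ e)%N : m m' / (m <= m')%N}.
Proof. by case: e => // e m m' le; rewrite leq_exp2r. Qed.

(** Both bounds are for the rising factorial [k (k + 1) ... (k + n - 1)], which
    is [n! * C(n + k - 1, n)]. *)
Lemma expn_le_ffact (n k : nat) : (0 < k)%N -> (k ^ n <= (n + k.-1) ^_ n)%N.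
Proof.
move=> k0; elim: n => [|n IH] //.
by rewrite addSn ffactSS expnS leq_mul //; lia.
Qed.

Lemma ffact_le_expn (n k : nat) : (0 < k)%N ->
  ((n.+1 + k.-1) ^_ n.+1 <= k * (k + n) ^ n)%N.
Proof.
move=> k0; elim: n => [|n IH]; first by rewrite ffactn1 muln1; lia.
rewrite addSn ffactSS expnS mulnCA leq_mul //; first by lia.
by apply: leq_trans IH _; rewrite leq_mul2l expn_homo ?orbT // addnS.
Qed.

(** The leading term of [(a N + b)^m] in [N], with an error of lower order;
    everything is multiplied by [N] to avoid the exponent [m - 1]. *)
Lemma expn_affine_le (a b m : nat) : exists c, forall N,
  (N * (a * N + b) ^ m <= a ^ m * N ^ m.+1 + c * N ^ m)%N.
Proof.
elim: m => [|m [c IH]]; first by exists 0%N => N; rewrite expn1 !expn0; lia.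
exists (c * a + b * a ^ m + b * c)%N => -[|N]; first by [].
set X := N.+1 in IH *.
have : (X * (a * X + b) ^ m * (a * X + b) <=
    (a ^ m * X ^ m.+1 + c * X ^ m) * (a * X + b))%N.
  by rewrite leq_mul2r IH orbT.
rewrite -mulnA -expnSr => le; apply: leq_trans le _.
have leX : (X ^ m <= X ^ m.+1)%N by rewrite expnS leq_pmull.
have := leq_mul (leqnn (b * c)%N) leX.
rewrite !expnS; nia.
Qed.

(** The leading terms in [N] of both sides of [multiplicity_kakeya]. *)
Lemma weighted_kakeya (F : finFieldType) (n : nat) (w : 'rV[F]_n.+1 -> nat)
    (A M : nat) :
  (forall x, (w x <= A)%N) ->
  (forall b, exists a, (M <= \sum_(t : F) w (a + t *: b)%R)%N) ->
  (M ^ n.+1 <= 2 ^ n.+1 * A ^ n * \sum_x w x)%N.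
Proof.
move=> wA line; set T := (\sum_x w x)%N.
have [->|M0] := posnP M; first by rewrite exp0n.
have [c cP] := expn_affine_le (2 * A) n n.
have bound N : (0 < N)%N ->
    (N * M ^ n.+1 <= N * (2 ^ n.+1 * A ^ n * T) + 2 * T * c)%N.
  move=> N0.
  have NM0 : (0 < N * M)%N by rewrite muln_gt0 N0.
  have le1 : ((N * M) ^ n.+1 <= 2 * N * T * (2 * A * N + n) ^ n)%N.
    apply: leq_trans (expn_le_ffact n.+1 NM0) _.
    rewrite -bin_ffact.
    apply: leq_trans (leq_mul (multiplicity_kakeya NM0 line) (leqnn _)) _.
    rewrite big_distrl /= big_mkcond /= /T big_distrr big_distrl /=.
    apply: leq_sum => x _; case: (posnP (w x)) => // w0.
    rewrite bin_ffact; apply: leq_trans (ffact_le_expn _ _) _.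
      by rewrite double_gt0 muln_gt0 N0.
    rewrite -mul2n mulnA leq_mul // expn_homo //.
    have := leq_mul (leqnn N) (wA x); lia.
  have le2 := leq_mul (leqnn N) le1.
  have NX : (0 < N ^ n.+1)%N by rewrite expn_gt0 N0.
  rewrite -(leq_pmul2l NX).
  have le3 := leq_mul (leqnn (2 * N * T)%N) (cP N).
  apply: (@leq_trans (N * (N * M) ^ n.+1)); first by rewrite expnMn mulnCA.
  apply: leq_trans le2 _; rewrite mulnCA.
  apply: leq_trans le3 _; rewrite expnMn !expnS; apply: eq_leq; ring.
rewrite leqNgt; apply/negP => lt.
(* The error term 2 T c does not depend on N, and any N > 2 T c refutes the
   strict inequality. *)
have := bound (2 * T * c).+1 isT.
have := leq_mul (leqnn (2 * T * c).+1) lt; lia.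
Qed.

(** The contrapositive of [weighted_kakeya], in a nonzero direction. *)
Lemma exists_light_direction (F : finFieldType) (n : nat) (w : 'rV[F]_n.+1 -> nat)
    (A : nat) : (forall x, (w x <= A)%N) ->
  exists2 b : 'rV[F]_n.+1, b != 0 & forall a,
    ((\sum_(t : F) w (a + t *: b)%R) ^ n.+1 <= 2 ^ n.+1 * A ^ n * \sum_x w x)%N.
Proof.
move=> wA; set X := (2 ^ n.+1 * A ^ n * \sum_x w x)%N.
apply: contrapT => H.
(* M is the least integer with M^(n+1) > X, so that line weights violating the
   bound are those which are at least M. *)
have exM : exists M, (X < M ^ n.+1)%N by exists X.+1; rewrite expnS leq_pmulr // expn_gt0.
case: (ex_minnP exM) => M XM minM.
have line b : b != 0 -> exists a, (M <= \sum_(t : F) w (a + t *: b)%R)%N.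
  move=> b0; apply: contrapT => H'; apply: H; exists b => // a.
  rewrite leqNgt; apply/negP => lt; apply: H'; exists a; exact: minM.
move: XM; apply/negP; rewrite -leqNgt; apply: weighted_kakeya => // b.
have [->|b0] := eqVneq b 0; last exact: line.
(* For b = 0, some point x of a heavy line in a nonzero direction has
   #|F| * w x >= M, by averaging. *)
have q0 : (0 < #|F|)%N by apply/card_gt0P; exists 0.
have [|a aM] := line (const_mx 1).
  by apply/eqP => /rowP/(_ 0)/eqP; rewrite !mxE oner_eq0.
apply: contrapT => H'.
have lt x : (#|F| * w x < M)%N.
  rewrite ltnNge; apply/negP => le; apply: H'; exists x.
  by under eq_bigr do rewrite scaler0 addr0; rewrite sum_nat_const.
have M0 : (0 < M)%N by apply: leq_ltn_trans (lt 0).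
have : (#|F| * M <= #|F| * M.-1)%N.
  apply: (@leq_trans (#|F| * \sum_(t : F) w (a + t *: const_mx 1)%R)).
    by rewrite leq_mul2l aM orbT.
  rewrite big_distrr /= -sum_nat_const; apply: leq_sum => t _.
  by rewrite -ltnS prednK.
by rewrite leq_pmul2l // -ltnS prednK // ltnn.
Qed.

(** * Projections and the Furstenberg bound *)

(** The projection of [F^(n+1)] onto [F^n] along the line spanned by [b]. *)
Lemma exists_projection (F : fieldType) (n : nat) (b : 'rV[F]_n.+1) : b != 0 ->
  exists f : 'Hom('rV[F]_n.+1, 'rV[F]_n), limg f = fullv /\ lker f = <[b]>%VS.
Proof.
move=> b0.
have rkb : \rank (cokermx b) = n.
  by rewrite mxrank_coker; have := rank_rV b; rewrite b0 => ->; rewrite subn1.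
have : exists B : 'M_(n.+1, \rank (cokermx b)), b *m B = 0 /\ row_full B.
  exists (col_base (cokermx b)); split; last exact: col_base_full.
  apply: (row_free_inj (row_base_free (cokermx b))).
  by rewrite -mulmxA mulmx_base mulmx_coker mul0mx.
rewrite rkb => -[B [bB fB]].
pose f : 'Hom('rV[F]_n.+1, 'rV[F]_n) := linfun (mulmxr B); exists f.
have fE x : f x = x *m B by rewrite lfunE.
have img : limg f = fullv.
  apply/vspaceP => y; rewrite memvf.
  have /submxP[x ->] : (y <= B)%MS by apply: submx_full.
  by rewrite -fE memv_img ?memvf.
split=> //; apply/esym/eqP; rewrite eqEdim -memvE memv_ker fE bB eqxx /=.
have := limg_ker_dim f fullv.
rewrite img capfv !dimvf /dim /= !mul1n dim_vline b0; lia.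
Qed.

Lemma mem_translate (F : finFieldType) (n : nat) (a x : 'rV[F]_n)
    (W : {vspace 'rV[F]_n}) : (x \in translate a W) = (x - a \in W).
Proof.
apply/imsetP/idP => [[y yW ->]|xW]; first by rewrite addrC addKr.
by exists (x - a) => //; rewrite addrC subrK.
Qed.

(** A [k]-dimensional subspace none of whose translates is too heavy, by
    induction on [k].  Push [w] forward along a light direction; the weights
    of the lines become point weights [w'], at most [A'] with
    [A'^n <= 2^n * A^(n-1) * T], and the total mass [T] does not change.
    The preimage of a light subspace for [w'] is light for [w]. *)
Lemma exists_light_subspace (F : finFieldType) (k n : nat) (w : 'rV[F]_n -> nat)
    (A : nat) : (k < n)%N -> (forall x, (w x <= A)%N) ->
  exists2 W : {vspace 'rV[F]_n}, \dim W = k & forall a,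
    ((\sum_(x in translate a W) w x) ^ n <=
       2 ^ (k * n) * A ^ (n - k) * (\sum_x w x) ^ k)%N.
Proof.
elim: k n w A => [|k IH] n w A kn wA.
  exists 0%VS; rewrite ?dimv0 // => a.
  rewrite mul0n !expn0 subn0 mul1n muln1; apply: expn_homo.
  rewrite (big_pred1 a) // => x /=.
  by rewrite mem_translate memv0 subr_eq0.
case: n => [//|n] in w wA kn *.
have [b b0 light] := exists_light_direction wA.
have [f [imf kerf]] := exists_projection b0.
set T := (\sum_x w x)%N in light *.
pose w' y := (\sum_(x | f x == y) w x)%N.
have w'light y : (w' y ^ n.+1 <= 2 ^ n.+1 * A ^ n * T)%N.
  have /memv_imgP[x0 _ ->] : y \in limg f by rewrite imf memvf.
  apply: leq_trans (light x0); apply: expn_homo; apply: eq_leq.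
  have inj : injective (fun t : F => x0 + t *: b).
    move=> t s /addrI/eqP; rewrite -subr_eq0 -scalerBl scaler_eq0 (negPf b0) orbF.
    by rewrite subr_eq0 => /eqP.
  rewrite -[RHS](big_imset _ (in2W inj)) /=; apply: eq_bigl => x.
  apply/idP/imsetP => [|[t _ ->]].
    rewrite -subr_eq0 -linearB -memv_ker kerf => /vlineP[t xt].
    by exists t => //; rewrite -xt addrC subrK.
  by rewrite linearD /= -subr_eq0 addrC addKr -memv_ker kerf memvZ ?memv_line.
(* A' is w' y0, the largest value of w'. *)
pose y0 := [arg max_(y > 0%R) w' y]%N.
have w'A y : (w' y <= w' y0)%N by rewrite /y0; case: arg_maxnP => // z _; apply.
have kn' : (k < n)%N by [].
have [W' dimW' lightW'] := IH n w' (w' y0) kn' w'A.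
exists (f @^-1: W')%VS.
  have := limg_ker_dim f (f @^-1: W')%VS.
  rewrite lpreimK ?imf ?subvf // dimW' (capv_idPr _); first by rewrite kerf dim_vline b0.
  by apply/subvP => x; rewrite memv_ker -memv_preim => /eqP ->; exact: mem0v.
move=> a; have := lightW' (f a).
have -> : (\sum_(y in translate (f a) W') w' y =
    \sum_(x in translate a (f @^-1: W')) w x)%N.
  rewrite [RHS](partition_big f (fun y => y \in translate (f a) W')) /=.
    apply: eq_bigr => y yW; apply: eq_bigl => x.
    case: eqP => [fx|]; last by rewrite andbF.
    by rewrite andbT mem_translate -memv_preim linearB -mem_translate /= fx yW.
  by move=> x; rewrite !mem_translate -memv_preim linearB.
have -> : (\sum_y w' y = T)%N by rewrite /T (partition_big f xpredT).
move: (\sum_(x in _) w x)%N => S; set A' := w' y0; move=> le1.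
have le2 : (A' ^ n.+1 <= 2 ^ n.+1 * A ^ n * T)%N by apply: w'light.
have n0 : (0 < n)%N by apply: leq_ltn_trans kn'.
(* The induction hypothesis bounds S^n; its power n + 1 is where the bound
   le2 on A'^(n+1) can be used. *)
rewrite -(leq_exp2r _ _ n0) -expnM mulnC expnM.
apply: leq_trans (expn_homo n.+1 le1) _.
rewrite !expnMn -!expnM [((n - k) * _)%N]mulnC [(A' ^ _)%N]expnM.
apply: leq_trans (leq_mul (leq_mul (leqnn _) (expn_homo (n - k) le2)) (leqnn _)) _.
rewrite !expnMn -!expnM subSS.
set m := (n - k)%N; have nE : n = (m + k)%N by rewrite subnK // ltnW.
have -> : (2 ^ (k * n * n.+1) * (2 ^ (n.+1 * m) * A ^ (n * m) * T ^ m) * T ^ (k * n.+1)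
  = 2 ^ (k * n * n.+1 + n.+1 * m) * A ^ (m * n) * T ^ (k.+1 * n))%N.
  have -> : (k.+1 * n = m + k * n.+1)%N by rewrite nE; ring.
  by rewrite !expnD [(n * m)%N]mulnC; ring.
rewrite !leq_mul // leq_exp2l // nE; nia.
Qed.

Lemma furstenberg_card (F : finFieldType) (n k m : nat) (S : {set 'rV[F]_n}) :
  (k < n)%N -> furstenberg k m S -> (m ^ n <= (2 ^ n * #|S|) ^ k)%N.
Proof.
move=> kn fS.
have [|W dimW light] := @exists_light_subspace F k n (fun x => x \in S) 1 kn.
  by move=> x; case: (_ \in _).
have [a mW] := fS W dimW.
apply: leq_trans (expn_homo n mW) _.
have -> : #|S :&: translate a W|%SET = (\sum_(x in translate a W) (x \in S))%N.
  rewrite -sum1_card big_mkcond [RHS]big_mkcond; apply: eq_bigr => x _.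
  by rewrite inE; case: (x \in S); case: (x \in translate a W).
apply: leq_trans (light a) _.
rewrite exp1n muln1 expnMn -expnM mulnC [(k * n)%N]mulnC mulnC.
by rewrite leq_mul //; apply: expn_homo; rewrite -sum1_card [X in (_ <= X)%N]big_mkcond.
Qed.

Theorem theorem1 (R : realType) (F : finFieldType) (q n k m : nat)
    (hq : #|F| = q) (hk : (0 < k)%N) (hm : (0 < m)%N)
    (hkn : (k < n)%N) (hmq : (m <= q ^ k)%N) :
  (2 ^+ n)^-1 * (m%:R `^ (n%:R / k%:R)) <=
    (furstenberg_number F n k m)%:R :> R.
Proof.
rewrite -hq in hmq.
have [[S fS <-] _] := @furstenberg_numberP F n k m hmq.
have := furstenberg_card hkn fS.
rewrite -(ler_nat R) !natrX natrM natrX => le.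
rewrite ler_pdivrMl ?exprn_gt0 //.
have k0 : k%:R != 0 :> R by rewrite pnatr_eq0 -lt0n.
have X0 : 0 <= 2 ^+ n * #|S|%:R :> R by rewrite mulr_ge0 ?exprn_ge0.
rewrite powRrM powR_mulrn //.
have -> : 2 ^+ n * #|S|%:R = ((2 ^+ n * #|S|%:R) ^+ k) `^ k%:R^-1 :> R.
  by rewrite -(powR_mulrn k X0) -powRrM divff // powRr1.
by apply: ge0_ler_powR => //; rewrite ?nnegrE ?invr_ge0 ?exprn_ge0.
Qed.
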